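(* Let $T$ be an oriented tree that is grounded, and let $U(T)=\{v\in V(T):\deg^-_T(v)\geq 2\}$. Suppose that the minimal subtree of $T$ containing the vertex set $U(T)$ is an out-arborescence. Then there exists an integer $d=d(T)$ such that every finite digraph $G$ with $\delta^+(G)\geq d$ contains $T$ as a subgraph.
   Context: Digraphs are finite, have no loops and no multiple copies of the same edge, but may contain two edges in opposite directions between a pair of vertices. An oriented tree is an orientation of an undirected tree. For an oriented tree $T$, a height function $h_T\colon V(T)\to\mathbb{Z}$ is a function with $h_T(v)=h_T(u)+1$ for every edge $(u,v)\in E(T)$ (unique up to an additive constant). $T$ is grounded if $h_T$ is constant on the set of vertices of in-degree at least $2$. An out-arborescence is an oriented tree in which all edges are oriented away from a designated root vertex. $\delta^+(G)$ is the minimum out-degree of $G$; containing $T$ as a subgraph means having a subgraph isomorphic to $T$. *)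

(* Defs.v *)
From mathcomp Require Import all_boot all_algebra.
Set Implicit Arguments. Unset Strict Implicit. Unset Printing Implicit Defensive.
Import GRing.Theory Num.Theory.

(* A digraph on a finite vertex type V is an edge relation t : rel V. *)

Definition und_adj (V : finType) (t : rel V) : rel V := fun a b => t a b || t b a.

Definition oriented_tree (V : finType) (t : rel V) : Prop :=
  [/\ 0 < #|V|,
      irreflexive t,
      (forall u v, t u v -> ~~ t v u),
      (forall u v, connect (und_adj t) u v) &
      #|[set p : V * V | t p.1 p.2]| = #|V| - 1].

Definition indeg (V : finType) (t : rel V) (v : V) : nat := #|[set u | t u v]|.

Definition Uset (V : finType) (t : rel V) : {set V} := [set v | 2 <= indeg t v].

Definition height_fun (V : finType) (t : rel V) (h : V -> int) : Prop :=
  forall u v, t u v -> h v = (h u + 1)%R.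

Definition grounded (V : finType) (t : rel V) : Prop :=
  exists h : V -> int, height_fun t h /\
    (forall u v, u \in Uset t -> v \in Uset t -> h u = h v).

Definition connected_set (V : finType) (t : rel V) (X : {set V}) : bool :=
  [forall x in X, forall y in X,
     connect [rel a b | und_adj t a b && (a \in X) && (b \in X)] x y].

(* vertex set of the minimal subtree containing A: intersection of all
   vertex sets of subtrees (connected vertex sets) containing A *)
Definition min_subtree (V : finType) (t : rel V) (A : {set V}) : {set V} :=
  [set v | [forall X : {set V}, (A \subset X) && connected_set t X ==> (v \in X)]].

(* the subtree of the oriented tree t induced on S is an out-arborescence:
   there is a root r in S from which every vertex of S is reached by a directed
   path inside S (for a tree this means all edges are oriented away from r).
   The empty subtree (S = set0) is accepted. *)
Definition out_arborescence_on (V : finType) (t : rel V) (S : {set V}) : Prop :=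
  S = set0 \/
  exists2 r, r \in S &
    forall v, v \in S -> connect [rel a b | t a b && (a \in S) && (b \in S)] r v.

Definition contains_subgraph (V W : finType) (t : rel V) (g : rel W) : Prop :=
  exists f : V -> W, injective f /\ forall u v, t u v -> g (f u) (f v).

Definition min_outdeg_ge (W : finType) (g : rel W) (d : nat) : Prop :=
  forall x, d <= #|[set y | g x y]|.

(* Main.v *)
Require Import Defs.
From mathcomp Require Import all_boot all_order all_algebra.
From mathcomp Require Import zify lra.

(** Host: a vertex is well fed if, after deleting any few other vertices, it
    is still the end of a directed path of length [l].  Let [pi] be a
    stationary distribution of the random walk on the host and let [v] maximise
    it.  If all out-degrees are at least [d], the stationary walk run backwards
    from [v] is at a given vertex at a given time with probability at most
    [1 / d], and it returns from a vertex to itself after a given number of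
    steps with probability at most [1 / d].  If [d] is large, some backward walk of length [l] therefore neither hits a
    given small set nor repeats a vertex, so [v] is well fed.  Let level [0]
    mean well fed, and level [k.+1] having many out-neighbours of level [k].
    There are vertices of every level, and below one of level [k] an
    out-arborescence embeds greedily with its vertices at depth [k] well fed.

    Tree: some vertex reaches all of [U(T)], and one of least height is a
    source [r].  By groundedness [U(T)] lies at a single depth [k] below [r], so
    everything below [r] embeds with [U(T)] mapped to well-fed vertices.  What
    remains is attached either by an out-edge, which is handled greedily, or by
    an in-edge at a vertex of [U(T)]; the ancestors reached by such an in-edge
    form a directed path, which is mapped into one of the paths feeding the
    image of that vertex. *)

Set Implicit Arguments.
Unset Strict Implicit.
Unset Printing Implicit Defensive.

Import Order.TTheory GRing.Theory Num.Theory.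

(* [v :: p] lists a directed path ending at [v], read backwards. *)
Definition backpath (T : eqType) (e : rel T) (v : T) (p : seq T) :=
  path [rel a b | e b a] v p && uniq (v :: p).

Definition has_backpath_off (T : finType) (e : rel T) l v (H : {set T}) :=
  exists p : seq T, [/\ size p = l, backpath e v p & [disjoint p & H]].

Lemma has_backpath_off_map (T U : finType) (e : rel T) (e' : rel U) (f : T -> U)
    l v (H : {set T}) (H' : {set U}) :
  injective f -> {homo f : x y / e x y >-> e' x y} -> f @^-1: H' \subset H ->
  has_backpath_off e l v H -> has_backpath_off e' l (f v) H'.
Proof.
move=> inj_f hom_f /subsetP sH [p [size_p /andP[path_p uniq_p] pH]].
exists (map f p); split; first by rewrite size_map.
  rewrite /backpath -map_cons map_inj_uniq // uniq_p andbT.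
  by apply: homo_path path_p => a b; apply: hom_f.
rewrite disjoint_subset; apply/subsetP => _ /mapP[x xp ->]; rewrite inE.
by apply: contraFN (disjointFr pH xp) => fxH; rewrite sH ?inE.
Qed.

Section MarkovChain.

Local Open Scope ring_scope.

Variables (R : realFieldType) (T : finType) (P : T -> T -> R).
Hypothesis P_ge0 : forall x y, 0 <= P x y.
Hypothesis sum_P : forall x, \sum_y P x y = 1.

Lemma sum_transport (m : T -> R) : \sum_y \sum_x m x * P x y = \sum_x m x.
Proof.
rewrite exchange_big; apply: eq_bigr => x _.
by rewrite -big_distrr sum_P /= mulr1.
Qed.

Lemma exists_fixed_measure : (0 < #|T|)%N ->
  exists2 u : T -> R, exists x, u x != 0 & forall y, \sum_x u x * P x y = u y.
Proof.
move=> T_gt0.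
pose A := \matrix_(i < #|T|, j < #|T|) P (enum_val i) (enum_val j).
have sum_rank (F : 'I_#|T| -> R) : \sum_i F i = \sum_x F (enum_rank x).
  exact: reindex (onW_bij _ (@enum_rank_bij T)).
have A1 : (A - 1%:M) *m const_mx 1 = 0 :> 'cV_#|T|.
  apply/colP => i; rewrite mulmxBl mul1mx !mxE sum_rank; apply/eqP.
  rewrite subr_eq0 -[eqbRHS](sum_P (enum_val i)); apply/eqP.
  by apply: eq_bigr => y _; rewrite !mxE enum_rankK mulr1.
have /rowV0Pn[u /sub_kermxP] : kermx (A - 1%:M) != 0.
  rewrite kermx_eq0 row_free_unit; apply/negP.
  move/mulKmx/(_ (const_mx 1 : 'cV_#|T|)); rewrite A1 mulmx0.
  by move/colP/(_ (Ordinal T_gt0))/eqP; rewrite !mxE eq_sym oner_eq0.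
rewrite mulmxBr mulmx1 => /eqP; rewrite subr_eq0 => /eqP uA /rV0Pn[i ui].
exists (fun x => u 0 (enum_rank x)) => [|y].
  by exists (enum_val i); rewrite enum_valK.
rewrite -{2}uA mxE sum_rank; apply: eq_bigr => x _.
by rewrite mxE !enum_rankK.
Qed.

Lemma subinvariant_invariant (m : T -> R) :
  (forall y, m y <= \sum_x m x * P x y) -> forall y, \sum_x m x * P x y = m y.
Proof.
move=> sub_m y; apply/eqP; rewrite -subr_eq0.
have /psumr_eq0P -> // : forall z, true -> 0 <= \sum_x m x * P x z - m z.
  by move=> z _; rewrite subr_ge0.
by rewrite sumrB sum_transport subrr.
Qed.

(* The absolute value of a fixed signed measure is subinvariant. *)
Lemma exists_stationary : (0 < #|T|)%N ->
  exists pi : T -> R, [/\ forall x, 0 <= pi x, exists x, 0 < pi x &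
                          forall y, \sum_x pi x * P x y = pi y].
Proof.
case/exists_fixed_measure => u [x ux] fix_u.
exists (fun x => `|u x|); split=> //; first by exists x; rewrite normr_gt0.
apply: subinvariant_invariant => y; rewrite -{1}fix_u.
apply: le_trans (ler_norm_sum _ _ _) _; apply: ler_sum => z _.
by rewrite normrM (ger0_norm (P_ge0 _ _)).
Qed.

Variable eps : R.
Hypothesis P_le : forall x y, P x y <= eps.

(* The times [1], ..., [l] are counted, not the start. *)
Fixpoint expected_visits l x y : R :=
  if l is l'.+1 then
    \sum_z ((x == z)%:R + expected_visits l' x z) * P z y
  else 0.

Lemma expected_visits_ge0 l x y : 0 <= expected_visits l x y.
Proof.
elim: l y => [|l IH] y //=; apply: sumr_ge0 => z _.
by rewrite mulr_ge0 ?addr_ge0 ?ler0n.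
Qed.

Lemma sum_expected_visits l x : \sum_y expected_visits l x y = l%:R.
Proof.
elim: l => [|l IH]; first by rewrite big1.
rewrite /= sum_transport big_split /= IH (bigD1 x) //= eqxx.
rewrite big1 ?addr0 ?nat1r //.
by move=> y /negPf; rewrite eq_sym => ->.
Qed.

Lemma expected_visits_le l x y : expected_visits l x y <= l%:R * eps.
Proof.
case: l => [|l]; first by rewrite mul0r.
rewrite -(sum_expected_visits l.+1 x) /= sum_transport big_distrl /=.
apply: ler_sum => z _.
by rewrite ler_wpM2l // addr_ge0 ?ler0n ?expected_visits_ge0.
Qed.

Variable pi : T -> R.
Hypothesis pi_ge0 : forall x, 0 <= pi x.
Hypothesis pi_fixed : forall y, \sum_x pi x * P x y = pi y.

(* Up to the factor [pi y], the expected number of visits to [H] in [l] steps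
   of the stationary chain run backwards from [y]. *)
Definition load l (H : {set T}) y := \sum_(h in H) pi h * expected_visits l h y.

Lemma loadS l H x :
  load l.+1 H x = \sum_y ((y \in H)%:R * pi y + load l H y) * P y x.
Proof.
rewrite /load /=; under eq_bigr do rewrite big_distrr.
rewrite exchange_big /=; apply: eq_bigr => y _.
under eq_bigr do rewrite mulrA mulrDr.
rewrite -big_distrl big_split /=; congr ((_ + _) * _).
have [yH|yH] := boolP (y \in H).
  rewrite mul1r (bigD1 y) //= eqxx mulr1 big1 ?addr0 // => h /andP[_ /negPf ->].
  by rewrite mulr0.
rewrite mul0r big1 // => h hH.
by case: eqP hH yH => [->|]; rewrite ?mulr0 // => ->.
Qed.

Lemma load_ge0 l H y : 0 <= load l H y.
Proof. by apply: sumr_ge0 => h _; rewrite mulr_ge0 ?expected_visits_ge0. Qed.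

Lemma loadU1_le l H x y :
  load l (x |: H) y <= pi x * expected_visits l x y + load l H y.
Proof.
have [xH|xH] := boolP (x \in H); last by rewrite /load big_setU1.
by rewrite (setUidPr _) ?sub1set // lerDr mulr_ge0 ?expected_visits_ge0.
Qed.

Lemma load_le c l (H : {set T}) y :
  (forall x, pi x <= c) -> load l H y <= #|H|%:R * (l%:R * eps) * c.
Proof.
move=> pi_le; rewrite -mulrA mulr_natl -sumr_const; apply: ler_sum => h _.
by rewrite mulrC ler_pM ?expected_visits_ge0 ?expected_visits_le.
Qed.

(* Method of conditional expectations: [cost y < pi y] says that [y] is unused
   and that the backward walk may go on from [y], and by stationarity the
   average over the predecessors [y] of [x] satisfies this. *)
Lemma has_backpath_off_load l (H : {set T}) x :
  load l H x + 'C(l.+1, 2)%:R * eps * pi x < pi x ->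
  has_backpath_off [rel y z | 0 < P y z] l x H.
Proof.
elim: l H x => [|l IH] H x load_x; first by exists [::]; rewrite eq_disjoint0.
have eps_ge0 : 0 <= eps := le_trans (P_ge0 x x) (P_le x x).
pose c : R := 'C(l.+1, 2)%:R * eps; pose H' := x |: H.
pose cost y := (y \in H')%:R * pi y + load l H' y + c * pi y.
have avg_cost : \sum_y cost y * P y x < \sum_y pi y * P y x.
  under eq_bigr do rewrite mulrDl -(mulrA c).
  rewrite big_split -big_distrr -loadS pi_fixed /=.
  apply: le_lt_trans load_x; rewrite (binS l.+1) bin1 natrD /c.
  have := loadU1_le l.+1 H x x; have := expected_visits_le l.+1 x x.
  by have := pi_ge0 x; nra.
have [y cost_y] : exists y, cost y * P y x < pi y * P y x.
  apply/existsP; apply: contraLR avg_cost => /existsPn cost_ge.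
  by rewrite -leNgt ler_sum // => y _; rewrite leNgt.
have Pyx : 0 < P y x.
  rewrite lt0r P_ge0 andbT; apply: contraTneq cost_y => ->.
  by rewrite !mulr0 ltxx.
move: cost_y; rewrite ltr_pM2r // /cost; case: (boolP (y \in H')) => [_|].
  have := load_ge0 l H' y; have : 0 <= c * pi y by rewrite !mulr_ge0 ?ler0n.
  by rewrite mul1r; lra.
rewrite !inE negb_or mul0r add0r => /andP[y_neq_x yH].
case/IH=> p [size_p /andP[path_p uniq_p] pH'].
exists (y :: p); split; rewrite /= ?size_p //.
  rewrite /backpath /= Pyx path_p -/(uniq (y :: p)) uniq_p inE eq_sym negb_or.
  by rewrite y_neq_x (disjointFl pH' (setU11 x H)).
by rewrite disjoint_cons yH (disjointWr (subsetUr _ _) pH').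
Qed.

Lemma has_backpath_off_argmax s l v (H : {set T}) :
  (forall x, pi x <= pi v) -> 0 < pi v ->
  (s * l + 'C(l.+1, 2))%:R * eps < 1 -> (#|H| <= s)%N ->
  has_backpath_off [rel y z | 0 < P y z] l v H.
Proof.
move=> pi_max pi_v small leH; apply: has_backpath_off_load.
have eps_ge0 : 0 <= eps := le_trans (P_ge0 v v) (P_le v v).
apply: le_lt_trans (_ : (s * l + 'C(l.+1, 2))%:R * eps * pi v < _); last first.
  by rewrite gtr_pMl.
rewrite natrD natrM !mulrDl lerD2r; apply: le_trans (load_le l H v pi_max) _.
by rewrite mulrA !ler_wpM2r ?ler_nat ?pi_ge0.
Qed.

End MarkovChain.

Section RandomWalk.

Local Open Scope ring_scope.

Variables (W : finType) (g : rel W) (d : nat).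
Hypotheses (d_gt0 : (0 < d)%N) (outdeg_g : min_outdeg_ge g d).

Definition step_prob x y : rat := (g x y)%:R / #|[set z | g x z]|%:R.

Lemma step_prob_ge0 x y : 0 <= step_prob x y.
Proof. by rewrite divr_ge0 ?ler0n. Qed.

Lemma step_prob_gt0 x y : 0 < step_prob x y -> g x y.
Proof. by rewrite /step_prob; case: (g x y); rewrite ?mul0r ?ltxx. Qed.

Lemma sum_step_prob x : \sum_y step_prob x y = 1.
Proof.
rewrite -big_distrl -natr_sum /=.
rewrite (_ : (\sum_y g x y)%N = #|[set z | g x z]|).
  by rewrite divff // pnatr_eq0 -lt0n (leq_trans d_gt0).
rewrite -sum1dep_card [RHS]big_mkcond.
by apply: eq_bigr => y _; case: (g x y).
Qed.

Lemma step_prob_le x y : step_prob x y <= d%:R^-1.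
Proof.
rewrite -[leRHS]mul1r ler_pM ?invr_ge0 ?ler0n ?lern1 ?leq_b1 //.
by rewrite lef_pV2 ?posrE ?ltr0n ?ler_nat ?(leq_trans d_gt0).
Qed.

End RandomWalk.

Definition well_fed (W : finType) (g : rel W) s l v :=
  [forall H : {set W}, (#|H| <= s) ==>
    [exists p : l.-tuple W, backpath g v p && [disjoint p & H]]].

Lemma well_fedP (W : finType) (g : rel W) s l v :
  reflect (forall H : {set W}, #|H| <= s -> has_backpath_off g l v H)
          (well_fed g s l v).
Proof.
apply: (iffP forallP) => fed H => [leH|].
  have /existsP[p /andP[back_p pH]] := implyP (fed H) leH.
  by exists p; rewrite size_tuple.
apply/implyP => /fed[p [/eqP size_p back_p pH]].
by apply/existsP; exists (Tuple size_p); rewrite back_p.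
Qed.

Lemma well_fed_map (W' W : finType) (g' : rel W') (g : rel W) (f : W' -> W)
    s l v :
  injective f -> {homo f : x y / g' x y >-> g x y} ->
  well_fed g' s l v -> well_fed g s l (f v).
Proof.
move=> inj_f hom_f /well_fedP fed; apply/well_fedP => H leH.
apply: (has_backpath_off_map inj_f hom_f (subxx _)); apply: fed.
apply: leq_trans leH; rewrite -(card_imset _ inj_f); apply: subset_leq_card.
by apply/subsetP => _ /imsetP[x + ->]; rewrite inE.
Qed.

(* The most likely position of the stationary random walk is well fed. *)
Lemma well_fed_exists (W : finType) (g : rel W) s l :
  0 < #|W| -> min_outdeg_ge g (s * l + 'C(l.+1, 2)).+1 ->
  exists v, well_fed g s l v.
Proof.
set d := (_ + _).+1 => W_gt0 outdeg_g.
have sum_P := sum_step_prob (ltn0Sn _) outdeg_g.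
have [pi [pi_ge0 [x pi_x] pi_fixed]] :=
  exists_stationary (@step_prob_ge0 _ g) sum_P W_gt0.
have [v _ pi_max] := @arg_maxP _ _ _ x predT pi isT.
exists v; apply/well_fedP => H leH.
apply: (has_backpath_off_map (f := id) (H := H)) => //.
- exact: step_prob_gt0.
- by apply/subsetP => z; rewrite inE.
apply: (has_backpath_off_argmax (@step_prob_ge0 _ g) sum_P
  (step_prob_le (ltn0Sn _) outdeg_g) pi_ge0 pi_fixed _ _ _ leH).
- by move=> y; apply: pi_max.
- exact: lt_le_trans pi_x (pi_max _ _).
by rewrite ltr_pdivrMr ?ltr0n // mul1r ltr_nat.
Qed.

Definition min_outdeg_in (W : finType) (g : rel W) (X : {set W}) (d : nat) :=
  forall x, x \in X -> d <= #|[set y in X | g x y]|.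

Lemma well_fed_exists_in (W : finType) (g : rel W) s l (X : {set W}) :
  X != set0 -> min_outdeg_in g X (s * l + 'C(l.+1, 2)).+1 ->
  exists2 v, v \in X & well_fed g s l v.
Proof.
case/set0Pn => x0 x0X outdeg_X.
have [||v fed_v] := @well_fed_exists {x | x \in X} (relpre val g) s l.
- by apply/card_gt0P; exists (exist _ x0 x0X).
- move=> x; apply: leq_trans (outdeg_X _ (valP x)) _.
  rewrite -(card_imset _ val_inj); apply: subset_leq_card; apply/subsetP => y.
  rewrite inE => /andP[yX gxy]; apply/imsetP.
  by exists (exist _ y yX); rewrite ?inE.
by exists (val v); [apply: valP | apply: well_fed_map val_inj _ fed_v].
Qed.

Section Levels.

Variables (W : finType) (g : rel W) (Q : pred W) (D : nat).

Fixpoint level k : pred W :=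
  if k is k'.+1 then [pred x | D <= #|[set y | g x y & level k' y]|] else Q.

(* If no vertex of [X] has level [k.+1], discarding the vertices of level [k]
   costs every vertex of [X] fewer than [D] out-neighbours. *)
Lemma level_exists_in d k (X : {set W}) :
  (forall Y, Y != set0 -> min_outdeg_in g Y d -> exists2 y, y \in Y & Q y) ->
  X != set0 -> min_outdeg_in g X (d + k * D) -> exists2 x, x \in X & level k x.
Proof.
move=> Q_exists; elim: k X => [|k IH] X X_neq0 outdeg_X.
  by apply: Q_exists; rewrite addn0 in outdeg_X.
apply/exists_inP; apply: contraT => /exists_inPn nolevel.
pose Y := [set x in X | ~~ level k x].
have outdeg_Y x : x \in X -> d + k * D < #|[set y in Y | g x y]|.
  move=> xX; have := nolevel x xX; have := outdeg_X x xX.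
  rewrite -(cardsID [set y | level k y] [set y in X | _]) /=.
  rewrite (_ : _ :\: _ = [set y in Y | g x y]); last first.
    by apply/setP => y; rewrite !inE andbA [_ && (y \in X)]andbC.
  have /subset_leq_card : [set y in X | g x y] :&: [set y | level k y]
      \subset [set y | g x y & level k y].
    by apply/subsetP => y; rewrite !inE -andbA => /andP[].
  by lia.
have [||y] := IH Y.
- have [x xX] := set0Pn _ X_neq0.
  have /card_gt0P[y] := leq_ltn_trans (leq0n _) (outdeg_Y _ xX).
  by rewrite inE => /andP[yY _]; apply/set0Pn; exists y.
- by move=> x; rewrite inE => /andP[/outdeg_Y /ltnW].
by rewrite inE => /andP[_ /negP].
Qed.

End Levels.

Lemma well_fed_level_exists (W : finType) (g : rel W) s l D k :
  0 < #|W| -> min_outdeg_ge g ((s * l + 'C(l.+1, 2)).+1 + k * D) ->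
  exists y, level g (well_fed g s l) D k y.
Proof.
move=> W_gt0 outdeg_g.
have [||y _ level_y] := @level_exists_in _ g (well_fed g s l) D _ k [set: W]
  (@well_fed_exists_in _ g s l).
- by rewrite -card_gt0 cardsT.
- by move=> x _; under eq_finset do rewrite inE; apply: outdeg_g.
by exists y.
Qed.

Definition out_closed (V : finType) (e : rel V) (X : {set V}) :=
  forall a b, a \in X -> e a b -> b \in X.

Lemma connect_boundary (V : finType) (e : rel V) (X : {set V}) a b :
  connect e a b -> a \in X -> b \notin X ->
  exists x y, [/\ x \in X, y \notin X & e x y].
Proof.
case/connectP => p + ->; elim: p a => [|z p IH] a /= => [_ ->|] //.
case/andP=> eaz path_p aX; have [/IH|zX _] := boolP (z \in X); first exact.
by exists a, z.
Qed.

Lemma connect_out_closed (V : finType) (e : rel V) (X : {set V}) a b :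
  out_closed e X -> connect e a b -> a \in X -> b \in X.
Proof.
move=> clX ab aX; apply: contraT.
case/(connect_boundary ab aX) => x [y [xX yX exy]].
by rewrite (clX x y xX exy) in yX.
Qed.

Lemma card_setCU1_lt (V : finType) (X : {set V}) x :
  x \notin X -> #|~: (x |: X)| < #|~: X|.
Proof.
move=> xX; have := cardsC X; have := cardsC (x |: X).
by rewrite cardsU1 xX; lia.
Qed.

Lemma card_imset_notin_lt (V W : finType) (f : V -> W) (X : {set V}) x :
  x \notin X -> #|f @: X| < #|V|.
Proof.
move=> xX; apply: leq_ltn_trans (leq_imset_card _ _) _.
by rewrite -cardsT proper_card // properT; apply: contraNneq xX => ->.
Qed.

Lemma fun_with_notin (V : finType) (W : Type) (f : V -> W) (X : {set V}) x y :
  x \notin X -> {in X, [eta f with x |-> y] =1 f}.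
Proof. by move=> xX z zX /=; case: eqP zX xX => // -> ->. Qed.

Lemma und_adj_sym (V : finType) (t : rel V) : symmetric (und_adj t).
Proof. by move=> a b; rewrite /und_adj orbC. Qed.

Lemma in_neighbor_uniq (V : finType) (t : rel V) v x y :
  v \notin Uset t -> t x v -> t y v -> x = y.
Proof.
rewrite inE -ltnNge ltnS => /card_le1_eqP eq_in txv tyv.
by apply: eq_in; rewrite inE.
Qed.

Section Subtrees.

Variables (V : finType) (t : rel V).
Hypothesis tree : oriented_tree t.
Implicit Types X : {set V}.

Lemma tree_irreflexive : irreflexive t.
Proof. by case: tree. Qed.

Lemma tree_asymmetric a b : t a b -> t b a = false.
Proof. by case: tree => _ _ asym _ _ /asym/negPf. Qed.

Lemma und_adj_boundary X : X != set0 -> X != setT ->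
  exists a b, [/\ a \in X, b \notin X & und_adj t a b].
Proof.
case: tree => _ _ _ conn _ /set0Pn[a aX]; rewrite -subTset => /subsetPn[b _ bX].
exact: connect_boundary (conn a b) aX bX.
Qed.

Definition num_edges X := \sum_(a in X) \sum_(b in X) t a b.

Definition neighbors X x := [set a in X | und_adj t x a].

Lemma neighbors_gt0 X x a : a \in X -> und_adj t a x -> 0 < #|neighbors X x|.
Proof.
by move=> aX ax; apply/card_gt0P; exists a; rewrite inE aX und_adj_sym.
Qed.

Lemma num_edgesU1 X x : x \notin X ->
  num_edges (x |: X) = num_edges X + #|neighbors X x|.
Proof.
move=> xX; rewrite /num_edges !big_setU1 //= tree_irreflexive.
under [X in _ + X = _]eq_bigr do rewrite big_setU1 //=.
rewrite big_split /= addnCA addnA addnC; congr (_ + _).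
rewrite -sum1dep_card big_mkcondr -big_split; apply: eq_bigr => a _ /=.
rewrite /und_adj; case: (boolP (t x a)) => [/tree_asymmetric -> //|_].
by case: (t a x).
Qed.

Lemma num_edges_setT : (num_edges setT).+1 = #|V|.
Proof.
case: tree => V_gt0 _ _ _ card_t; rewrite -(subnK V_gt0) addn1 -card_t.
rewrite -sum1dep_card big_mkcond /num_edges pair_big; congr _.+1.
by apply: eq_big => [p|p _]; rewrite ?inE //; case: (t p.1 p.2).
Qed.

Lemma num_edges_lt X : X != set0 -> num_edges X < #|X|.
Proof.
have [n] := ubnP #|~: X|; elim: n X => // n IH X; rewrite ltnS => leXn X0.
have [->|XT] := eqVneq X setT; first by rewrite num_edges_setT cardsT.
have [a [b [aX bX /(neighbors_gt0 aX) nbr_b]]] := und_adj_boundary X0 XT.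
have := IH (b |: X) (leq_trans (card_setCU1_lt bX) leXn).
by rewrite num_edgesU1 // cardsU1 bX -card_gt0 cardsU1 bX => /(_ isT); lia.
Qed.

(* In a tree, the connected vertex sets are those spanning the largest possible
   number of edges. *)
Definition subtree X := (num_edges X).+1 == #|X|.

Lemma subtree_neq0 X : subtree X -> X != set0.
Proof. by rewrite -card_gt0 => /eqP <-. Qed.

Lemma subtree1 x : subtree [set x].
Proof. by rewrite /subtree /num_edges !big_set1 tree_irreflexive cards1. Qed.

Lemma subtree_card_neighbors X x :
  subtree X -> x \notin X -> #|neighbors X x| <= 1.
Proof.
move=> /eqP subX xX; have : x |: X != set0 by rewrite -card_gt0 cardsU1 xX.
by move/num_edges_lt; rewrite num_edgesU1 // cardsU1 xX -subX; lia.
Qed.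

Lemma subtreeU1 X x a :
  subtree X -> x \notin X -> a \in X -> und_adj t a x -> subtree (x |: X).
Proof.
move=> subX xX aX /(neighbors_gt0 aX); have := subtree_card_neighbors subX xX.
by move: subX; rewrite /subtree num_edgesU1 // cardsU1 xX; lia.
Qed.

Lemma subtree_neighbor_uniq X x a b : subtree X -> x \notin X ->
  a \in X -> b \in X -> und_adj t a x -> und_adj t b x -> a = b.
Proof.
move=> subX /(subtree_card_neighbors subX)/card_le1_eqP nbr_eq aX bX ax bx.
by apply: nbr_eq; rewrite inE ?aX ?bX und_adj_sym.
Qed.

End Subtrees.

Section InClosedSets.

Variables (V : finType) (t : rel V).
Implicit Types X Z : {set V}.

Definition in_closed_off Z X :=
  forall a x, a \in X -> a \notin Z -> t x a -> x \in X.

Lemma in_closed_off_source x :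
  (forall y, ~~ t y x) -> in_closed_off (Uset t) [set x].
Proof. by move=> source_x a y /set1P -> _; rewrite (negPf (source_x y)). Qed.

Lemma in_closed_off_out X a b : in_closed_off (Uset t) X ->
  a \in X -> t a b -> in_closed_off (Uset t) (b |: X).
Proof.
move=> clX aX tab c x /setU1P[->|cX] cU txc; apply/setU1P; right.
  by rewrite (in_neighbor_uniq cU txc tab).
exact: clX cX cU txc.
Qed.

Lemma in_closed_off_in X w x : in_closed_off (w |: Uset t) X ->
  t x w -> in_closed_off (x |: Uset t) (x |: X).
Proof.
move=> clX txw a z aX; rewrite in_setU1 negb_or => /andP[a_neq_x aU] tza.
have {}aX : a \in X by move: aX; rewrite in_setU1 (negPf a_neq_x).
have [aw|a_neq_w] := eqVneq a w; apply/setU1P.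
  by left; rewrite aw in aU tza; apply: in_neighbor_uniq tza txw.
by right; apply: clX tza; rewrite // in_setU1 negb_or a_neq_w.
Qed.

End InClosedSets.

Section PartialEmbeddings.

Variables (V W : finType) (t : rel V) (g : rel W).
Hypothesis tree : oriented_tree t.
Implicit Types (X : {set V}) (f : V -> W).

Definition partial_embedding X f :=
  [/\ subtree t X, {in X &, injective f} &
      {in X &, {homo f : u v / t u v >-> g u v}}].

Lemma partial_embedding1 x y : partial_embedding [set x] (fun=> y).
Proof.
split; first exact: subtree1.
  by move=> u v /set1P -> /set1P ->.
by move=> u v /set1P -> /set1P ->; rewrite tree_irreflexive.
Qed.

Lemma partial_embeddingT f : partial_embedding setT f -> contains_subgraph t g.
Proof.
by case=> _ inj_f hom_f; exists f; split=> u v; [apply: inj_f | apply: hom_f].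
Qed.

Lemma partial_embeddingU1 X f x a y : partial_embedding X f ->
  x \notin X -> a \in X -> und_adj t a x -> y \notin f @: X ->
  (t a x -> g (f a) y) -> (t x a -> g y (f a)) ->
  partial_embedding (x |: X) [eta f with x |-> y].
Proof.
move=> [subX inj_f hom_f] xX aX ax yX g_out g_in.
set f' := [eta _ with _ |-> _].
have fx : f' x = y by rewrite /= eqxx.
have fX z : z \in X -> f' z = f z by exact: fun_with_notin.
have f_neq_y z : z \in X -> f z <> y.
  by move=> zX fzy; rewrite -fzy imset_f in yX.
have nbr_a z : z \in X -> und_adj t z x -> z = a.
  by move=> zX zx; apply: (subtree_neighbor_uniq tree subX xX).
split; first exact: (subtreeU1 tree subX xX aX ax).
  move=> u v /setU1P[->|uX] /setU1P[->|vX] //; rewrite ?fx ?fX //.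
  - by move/esym/f_neq_y.
  - by move/f_neq_y.
  - exact: inj_f.
move=> u v /setU1P[->|uX] /setU1P[->|vX] tuv; rewrite ?fx ?fX //.
- by rewrite tree_irreflexive in tuv.
- have v_a : v = a by apply: nbr_a; rewrite // /und_adj tuv orbT.
  by rewrite v_a in tuv *; apply: g_in.
- have u_a : u = a by apply: nbr_a; rewrite // /und_adj tuv.
  by rewrite u_a in tuv *; apply: g_out.
exact: hom_f.
Qed.

Lemma partial_embedding_out X f a b (Y : {set W}) : partial_embedding X f ->
  a \in X -> b \notin X -> t a b -> #|V| <= #|Y| ->
  {in Y, forall y, g (f a) y} ->
  exists2 y, y \in Y & partial_embedding (b |: X) [eta f with b |-> y].
Proof.
move=> emb aX bX tab leY gY.
have /subsetPn[y yY yX] : ~~ (Y \subset f @: X).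
  apply: contraTN leY => /subset_leq_card leX; rewrite -ltnNge.
  exact: leq_ltn_trans leX (card_imset_notin_lt f bX).
exists y => //; apply: (partial_embeddingU1 emb bX aX _ yX) => [|_|].
- by rewrite /und_adj tab.
- exact: gY.
by rewrite tree_asymmetric.
Qed.

Lemma partial_embedding_in X f x w y : partial_embedding X f ->
  w \in X -> x \notin X -> t x w -> y \notin f @: X -> g y (f w) ->
  partial_embedding (x |: X) [eta f with x |-> y].
Proof.
move=> emb wX xX txw yX gyw; apply: (partial_embeddingU1 emb xX wX _ yX) => //.
  by rewrite /und_adj txw orbT.
by rewrite tree_asymmetric.
Qed.

Lemma out_closed_extension (fit : V -> pred W) X f :
  (forall a b y, t a b -> fit a y -> #|V| <= #|[set z | g y z & fit b z]|) ->
  partial_embedding X f -> in_closed_off t (Uset t) X ->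
  {in X, forall v, fit v (f v)} ->
  exists X' f', [/\ X \subset X', out_closed t X', partial_embedding X' f',
    in_closed_off t (Uset t) X' & {in X', forall v, fit v (f' v)}].
Proof.
move=> fit_out; have [n] := ubnP #|~: X|; elim: n X f => // n IH X f.
rewrite ltnS => leXn emb clX fitX.
have [/existsP[[a b] /= /and3P[aX bX tab]]|/existsPn out_clX] :=
    boolP [exists p, [&& p.1 \in X, p.2 \notin X & t p.1 p.2]]; last first.
  exists X, f; split=> // a b aX tab.
  by have := out_clX (a, b); rewrite /= aX tab andbT negbK.
have leY := fit_out a b (f a) tab (fitX a aX).
have [|y] := partial_embedding_out emb aX bX tab leY.
  by move=> y; rewrite inE => /andP[].
rewrite inE => /andP[_ fit_y] emb'.
have [|v /setU1P[->|vX]|X' [f' [sX' ? ? ? ?]]] :=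
  IH _ _ _ emb' (in_closed_off_out clX aX tab).
- exact: leq_trans (card_setCU1_lt bX) leXn.
- by rewrite /= eqxx.
- by rewrite (fun_with_notin f y bX vX) fitX.
by exists X', f'; split=> //; apply: subset_trans sX'; apply: subsetUr.
Qed.

Definition fed_embedding X f :=
  [/\ partial_embedding X f, Uset t \subset X &
      {in Uset t, forall u, well_fed g #|V| #|V| (f u)}].

Lemma fed_embeddingU1 X f x y : fed_embedding X f -> x \notin X ->
  partial_embedding (x |: X) [eta f with x |-> y] ->
  fed_embedding (x |: X) [eta f with x |-> y].
Proof.
move=> [_ UX fed] xX emb; split=> [//||u uU].
  exact: subset_trans UX (subsetUr _ _).
by rewrite (fun_with_notin f y xX (subsetP UX u uU)) fed.
Qed.

Definition spare_backpath X f w p :=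
  [/\ backpath g (f w) p, #|~: X| <= size p & [disjoint p & f @: X]].

Lemma spare_backpath_step X f w x y p : fed_embedding X f ->
  w \in X -> x \notin X -> t x w -> spare_backpath X f w (y :: p) ->
  fed_embedding (x |: X) [eta f with x |-> y] /\
  spare_backpath (x |: X) [eta f with x |-> y] x p.
Proof.
move=> fedX wX xX txw [/andP[/= /andP[gyw path_p] /andP[_ uniq_yp]] leXp].
rewrite disjoint_cons => /andP[yX pX]; have [emb _ _] := fedX; split.
  exact: (fed_embeddingU1 fedX xX (partial_embedding_in emb wX xX txw yX gyw)).
split; first by rewrite /backpath /= eqxx path_p.
  exact: leq_trans (card_setCU1_lt xX) leXp.
rewrite imsetU1 /= eqxx (eq_in_imset (fun_with_notin f y xX)) disjoint_subset.
apply/subsetP => z zp; rewrite !inE negb_or (disjointFr pX zp) andbT.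
by apply: contraTneq zp => ->; case/andP: uniq_yp.
Qed.

Lemma absorb_ancestors p X f w x : fed_embedding X f ->
  in_closed_off t (w |: Uset t) X -> w \in X -> x \notin X -> t x w ->
  spare_backpath X f w p ->
  exists X' f', [/\ x |: X \subset X', fed_embedding X' f' &
                    in_closed_off t (Uset t) X'].
Proof.
elim: p X f w x => [|y p IH] X f w x fedX clX wX xX txw spare.
  case: spare => _; rewrite leqn0 => /eqP/cards0_eq/setP/(_ x).
  by rewrite !inE xX.
have [fed' spare'] := spare_backpath_step fedX wX xX txw spare.
have cl' := in_closed_off_in clX txw.
have [/existsP[z /andP[zX tzx]]|/existsPn cl_x] :=
    boolP [exists z, (z \notin x |: X) && t z x].
  have [X' [f' [sX' ? ?]]] := IH _ _ _ _ fed' cl' (setU11 x X) zX tzx spare'.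
  by exists X', f'; split=> //; apply: subset_trans sX'; apply: subsetUr.
exists (x |: X), [eta f with x |-> y]; split=> // a z aX aU tza.
have [a_x|a_neq_x] := eqVneq a x.
  by have := cl_x z; rewrite -a_x tza andbT negbK.
by apply: cl' tza; rewrite // in_setU1 negb_or a_neq_x.
Qed.

Lemma fed_embedding_complete X f : min_outdeg_ge g #|V| ->
  fed_embedding X f -> in_closed_off t (Uset t) X -> contains_subgraph t g.
Proof.
move=> outdeg_g; have [n] := ubnP #|~: X|; elim: n X f => // n IH X f.
rewrite ltnS => leXn fedX clX; have [emb UX fed] := fedX.
have [XT|X_neqT] := eqVneq X setT.
  by apply: (@partial_embeddingT f); rewrite -XT.
have X_neq0 : X != set0 by case: emb => /subtree_neq0.
have [a [b [aX bX /orP[tab|tba]]]] := und_adj_boundary tree X_neq0 X_neqT.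
  have [|y _ emb'] := partial_embedding_out emb aX bX tab (outdeg_g (f a)).
    by move=> y; rewrite inE.
  apply: IH (fed_embeddingU1 fedX bX emb') (in_closed_off_out clX aX tab).
  exact: leq_trans (card_setCU1_lt bX) leXn.
have aU : a \in Uset t by apply: contraR bX => aU; apply: clX aX aU tba.
have /well_fedP/(_ _ (ltnW (card_imset_notin_lt f bX))) := fed a aU.
case=> p [size_p back_p pX].
have [||X' [f' [sX' fed' cl']]] := absorb_ancestors fedX _ aX bX tba (p := p).
- by move=> c z cX; rewrite in_setU1 negb_or => /andP[_]; apply: clX.
- by split; rewrite // size_p max_card.
apply: IH fed' cl'; apply: leq_trans leXn.
by apply: leq_ltn_trans (card_setCU1_lt bX); rewrite subset_leq_card ?setCS.
Qed.

End PartialEmbeddings.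

Lemma grounded_height (V : finType) (t : rel V) : grounded t ->
  exists (h : V -> int) (c : int),
    height_fun t h /\ {in Uset t, forall u, h u = c}.
Proof.
case=> h [h_height h_U]; exists h.
have [u0 u0U|U0] := pickP [in Uset t]; last first.
  by exists 0%R; split=> // u; rewrite U0.
by exists (h u0); split=> // u uU; apply: h_U.
Qed.

Section Reaching.

Variables (V : finType) (t : rel V).
Implicit Types A S : {set V}.

Lemma sub_min_subtree A : A \subset min_subtree t A.
Proof.
apply/subsetP => a aA; rewrite inE; apply/forallP => X.
by apply/implyP => /andP[/subsetP AX _]; apply: AX.
Qed.

Lemma out_arborescence_on_root A S : 0 < #|V| -> A \subset S ->
  out_arborescence_on t S -> exists r, {in A, forall a, connect t r a}.
Proof.
move=> /card_gt0P[v _] /subsetP AS [S0|[r _ reach]].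
  by exists v => a /AS; rewrite S0 inE.
exists r => a /AS/reach; apply: connect_sub => x y /= /andP[/andP[txy _] _].
exact: connect1.
Qed.

Lemma exists_source_reaching h A : height_fun t h ->
  (exists r, {in A, forall a, connect t r a}) ->
  exists2 r, forall x, ~~ t x r & {in A, forall a, connect t r a}.
Proof.
move=> h_height [r0 /forall_inP reach0].
pose reaches_A r := [forall a in A, connect t r a].
have [r /forall_inP reach min_r] := @arg_minP _ _ _ r0 reaches_A h reach0.
exists r => // x; apply/negP => txr.
have /min_r : reaches_A x.
  by apply/forall_inP => a aA; apply: connect_trans (connect1 txr) (reach a aA).
by rewrite (h_height _ _ txr); lia.
Qed.

End Reaching.

Section LevelsByHeight.

Variables (V W : finType) (t : rel V) (g : rel W) (Q : pred W) (D : nat).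
Variables (h : V -> int) (c : int).

Definition fits_level v : pred W :=
  fun y => (h v <= c)%R ==> level g Q D `|c - h v| y.

Lemma fits_level_out a b y : height_fun t h -> min_outdeg_ge g D ->
  t a b -> fits_level a y -> D <= #|[set z | g y z & fits_level b z]|.
Proof.
move=> h_height outdeg_g /h_height h_b; rewrite /fits_level.
have [h_b_le|_] := boolP (h b <= c)%R => fit_a; last first.
  by under eq_finset do rewrite andbT; apply: outdeg_g.
have [h_a_le dist_a] : (h a <= c)%R /\ `|c - h a| = `|c - h b|.+1 by split; lia.
by move: fit_a; rewrite h_a_le dist_a.
Qed.

End LevelsByHeight.

Theorem theorem1p5 (V : finType) (t : rel V) :
  oriented_tree t -> grounded t ->
  out_arborescence_on t (min_subtree t (Uset t)) ->
  exists d : nat, forall (W : finType) (g : rel W),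
    0 < #|W| -> irreflexive g -> min_outdeg_ge g d ->
    contains_subgraph t g.
Proof.
move=> tree /grounded_height[h [c [h_height h_U]]] arb.
have [V_gt0 _ _ _ _] := tree.
have [r source_r reach_U] := exists_source_reaching h_height
  (out_arborescence_on_root V_gt0 (sub_min_subtree t _) arb).
pose n := #|V|; pose k := `|c - h r|.
exists ((n * n + 'C(n.+1, 2)).+1 + k * n) => W g W_gt0 _ outdeg_g.
have outdeg_n : min_outdeg_ge g n.
  by move=> x; apply: leq_trans (outdeg_g x); nia.
have [y level_y] := well_fed_level_exists W_gt0 outdeg_g.
pose fit := fits_level g (well_fed g n n) n h c.
have fit_r : {in [set r], forall v, fit v y}.
  by move=> v /set1P ->; apply/implyP.
have [X [f [rX out_clX emb clX fitX]]] :=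
  out_closed_extension tree (fun _ _ _ => fits_level_out h_height outdeg_n)
    (partial_embedding1 g tree r y) (in_closed_off_source source_r) fit_r.
have UX : Uset t \subset X.
  apply/subsetP => u /reach_U ru; apply: connect_out_closed ru _ => //.
  by rewrite -sub1set.
apply: (fed_embedding_complete tree outdeg_n _ clX (f := f)); split=> // u uU.
by have := fitX u (subsetP UX u uU); rewrite /fit /fits_level h_U // lexx subrr.
Qed.
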